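(* Let $A$ be a finite set and let $(X^a\times Y^a,c^a)_{a\in A}$ be a family of NNCC spaces, with costs $c^a\colon X^a\times Y^a\to(-\infty,+\infty]$. Let $\boldsymbol X=\prod_{a\in A}X^a$, $\boldsymbol Y=\prod_{a\in A}Y^a$ and $\boldsymbol c(\boldsymbol x,\boldsymbol y)=\sum_{a\in A}c^a(x^a,y^a)$ on $\boldsymbol X\times\boldsymbol Y$. Then $(\boldsymbol X\times\boldsymbol Y,\boldsymbol c)$ is an NNCC space.
   Context: For arbitrary sets $X,Y$ and a function $c\colon X\times Y\to[-\infty,+\infty]$: given a path $\mathrm x\colon[0,1]\to X$ (an arbitrary function; no continuity is required) and $\bar y\in Y$, the pair $(\mathrm x,\bar y)$ is a variational c-segment on $(X\times Y,c)$ if $c(\mathrm x(s),\bar y)$ is finite for all $s\in[0,1]$ and, for all $s\in(0,1)$ and $y\in Y$, $$c(\mathrm x(s),\bar y)-c(\mathrm x(s),y)\le (1-s)[c(\mathrm x(0),\bar y)-c(\mathrm x(0),y)]+s[c(\mathrm x(1),\bar y)-c(\mathrm x(1),y)],$$ with the usual arithmetic in $[-\infty,+\infty]$ and the rule $(+\infty)+(-\infty)=(-\infty)+(+\infty)=+\infty$ in the right-hand side. $(X\times Y,c)$ is an NNCC space if for every $(x_0,x_1,\bar y)\in X\times X\times Y$ such that $c(x_0,\bar y)$ and $c(x_1,\bar y)$ are finite, there exists a variational c-segment $(\mathrm x,\bar y)$ with $\mathrm x(0)=x_0$, $\mathrm x(1)=x_1$. *)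

(* Defs.v *)
From HB Require Import structures.
From mathcomp Require Import all_boot all_order all_algebra.
From mathcomp Require Import all_classical all_reals all_analysis.

Set Implicit Arguments.
Unset Strict Implicit.
Unset Printing Implicit Defensive.

Import Order.TTheory GRing.Theory Num.Theory.
Local Open Scope ring_scope.

(* The path is a function on the closed unit interval [{i01 R}].  The two
   weighted differences on the right-hand side are added with the dual addition
   [%dE], for which [+oo + -oo = +oo].  In every difference [c (x s) ybar - _]
   the first term is finite, so there the choice of addition is immaterial. *)
Definition variational_csegment (R : realType) (X Y : Type)
    (c : X -> Y -> \bar R) (x : {i01 R} -> X) (ybar : Y) : Prop :=
  (forall s : {i01 R}, c (x s) ybar \is a fin_num) /\
  (forall (s : {i01 R}) (y : Y), 0 < s%:num < 1 ->
    (c (x s) ybar - c (x s) y <=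
     ((1 - s%:num)%R%:E * (c (x 0%R%:i01) ybar - c (x 0%R%:i01) y)%E
      + (s%:num)%:E * (c (x 1%R%:i01) ybar - c (x 1%R%:i01) y)%E)%dE)%E).

Definition NNCC_space (R : realType) (X Y : Type) (c : X -> Y -> \bar R) : Prop :=
  forall (x0 x1 : X) (ybar : Y),
    c x0 ybar \is a fin_num -> c x1 ybar \is a fin_num ->
    exists x : {i01 R} -> X,
      [/\ variational_csegment c x ybar, x 0%:i01 = x0 & x 1%:i01 = x1].

Definition product_cost (R : realType) (A : finType) (X Y : A -> Type)
    (c : forall a, X a -> Y a -> \bar R)
    (x : forall a, X a) (y : forall a, Y a) : \bar R :=
  (\sum_(a : A) c a (x a) (y a))%E.

(* Main.v *)
Require Import Defs.
From HB Require Import structures.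
From mathcomp Require Import all_boot all_order all_algebra.
From mathcomp Require Import all_classical all_reals all_analysis.

(** Choose a variational c-segment in each factor and run all of them in
    parallel.  The defining inequality is linear in the cost, so summing the
    factorwise inequalities over [A] gives the one for the product.

    What needs care is the arithmetic with infinite values.  An infinite term
    makes a sum infinite, so endpoints of finite total cost have finite cost in
    every factor ([product_cost_fin_num]) and the factorwise segments exist.
    As no cost equals [-oo], each difference [c a (x s) ybar - c a (x s) y]
    with finite first term is below [+oo], and below [+oo] addition is free of
    the conflict between infinities: sums commute with subtraction
    ([product_costB]) and with scaling, and the dual addition is the ordinary
    one ([dual_convex_combinationE]). *)

Set Implicit Arguments.
Unset Strict Implicit.
Unset Printing Implicit Defensive.

Import Order.TTheory GRing.Theory Num.Theory.
Local Open Scope ring_scope.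

Lemma adde_def_lty (R : realDomainType) (u v : \bar R) :
  (u < +oo)%E -> (v < +oo)%E -> (u +? v)%E.
Proof. by case: u v => [u||] [v||]. Qed.

Lemma adde_def_gtNy (R : realDomainType) (u v : \bar R) :
  (-oo < u)%E -> (-oo < v)%E -> (u +? v)%E.
Proof. by case: u v => [u||] [v||]. Qed.

Lemma sube_lty_gtNy (R : realDomainType) (u v : \bar R) :
  u \is a fin_num -> (-oo < v)%E -> (u - v < +oo)%E.
Proof. by case: u v => [u||] [v||] // _ _; rewrite -?EFinB ltry. Qed.

(** Both terms of a convex combination of values below [+oo] are again below
    [+oo], so that no conflict between infinities can arise. *)
Lemma dual_convex_combinationE (R : realType) (s : {i01 R}) (u v : \bar R) :
  (u < +oo)%E -> (v < +oo)%E ->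
  ((1 - s%:num)%R%:E * u + s%:num%:E * v)%dE =
  ((1 - s%:num)%R%:E * u + s%:num%:E * v)%E.
Proof.
move=> uy vy; apply: DualAddTheoryNumDomain.dual_addeE_def.
by apply: adde_def_lty; apply: lte_mul_pinfty; rewrite // lee_fin ?subr_ge0.
Qed.

Section ProductCost.
Variables (R : realType) (A : finType) (X Y : A -> Type).
Variable c : forall a : A, X a -> Y a -> \bar R.
Hypothesis c_gtNy : forall (a : A) (x : X a) (y : Y a), (-oo < c x y)%E.

Implicit Types (x : forall a, X a) (y : forall a, Y a).

(** Infinite terms never cancel: adding [-oo] to [+oo] still gives an infinite
    value. *)
Lemma product_cost_fin_num x y :
  product_cost c x y \is a fin_num <->
  forall a, c (x a) (y a) \is a fin_num.
Proof.
split=> [/sum_fin_numP cxy a|cxy]; last by apply/sum_fin_numP => a _ _.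
by apply: cxy; rewrite ?mem_index_enum.
Qed.

(** Subtracting term by term is legitimate although [product_cost c x y'] may
    be [+oo]: the opposites of its terms never include [+oo]. *)
Lemma product_costB x y y' :
  (product_cost c x y - product_cost c x y' =
   \sum_(a : A) (c (x a) (y a) - c (x a) (y' a)))%E.
Proof.
rewrite big_split /=; congr (_ + _)%E.
by rewrite sumeN // => a b _ _; exact: adde_def_gtNy.
Qed.

Lemma variational_csegment_product (p : forall a, {i01 R} -> X a) y :
  (forall a, variational_csegment (c (a := a)) (p a) (y a)) ->
  variational_csegment (product_cost c) (fun s a => p a s) y.
Proof.
move=> cp.
have cp_fin s a : c (p a s) (y a) \is a fin_num by case: (cp a).
have cp_sum_fin s : product_cost c (fun a => p a s) y \is a fin_num.
  by apply/product_cost_fin_num => a; exact: cp_fin.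
split=> // s y' s01.
have diff_lty t a : (c (p a t) (y a) - c (p a t) (y' a) < +oo)%E.
  exact: sube_lty_gtNy.
rewrite !product_costB dual_convex_combinationE; first last.
- exact: lte_sum_pinfty.
- exact: lte_sum_pinfty.
rewrite !fin_num_sume_distrr //; first last.
- by move=> a b _ _; exact: adde_def_lty.
- by move=> a b _ _; exact: adde_def_lty.
rewrite -big_split /=; apply: lee_sum => a _.
rewrite -dual_convex_combinationE //.
by case: (cp a) => _; exact.
Qed.

End ProductCost.

Theorem proposition2p13 (R : realType) (A : finType) (X Y : A -> Type)
    (c : forall a : A, X a -> Y a -> \bar R)
    (c_gtNy : forall (a : A) (x : X a) (y : Y a), (-oo < c a x y)%E)
    (c_NNCC : forall a : A, NNCC_space (c a)) :
  NNCC_space (product_cost c).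
Proof.
move=> x0 x1 y /product_cost_fin_num cx0 /product_cost_fin_num cx1.
pose p a := projT1 (cid (c_NNCC a _ _ _ (cx0 a) (cx1 a))).
have pP a : [/\ variational_csegment (c a) (p a) (y a),
    p a 0%:i01 = x0 a & p a 1%:i01 = x1 a].
  exact: projT2 (cid (c_NNCC a _ _ _ (cx0 a) (cx1 a))).
exists (fun s a => p a s); split.
- by apply: variational_csegment_product => // a; case: (pP a).
- by apply: functional_extensionality_dep => a; case: (pP a).
- by apply: functional_extensionality_dep => a; case: (pP a).
Qed.
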